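(* Let $X$, $Y$ be Banach spaces, let $T,S\in B(X,Y)$ and let $T$ be a finite rank operator. Then there is an analytic generalized resolvent for the linear pencil $\lambda\mapsto T-\lambda S$ on a neighborhood of $0$ if and only if there exists a neighborhood $U$ of $0$ such that $$\operatorname{Rank}(T-\lambda S)=\operatorname{Rank} T,\qquad \forall\,\lambda\in U.$$
   Context: All spaces are complex. $B(X,Y)$ is the Banach space of bounded linear operators from $X$ to $Y$; $\operatorname{Rank} A$ is the dimension of the range of $A$. For an open set $U\subset\mathbb{C}$, a function $U\ni\lambda\mapsto G(\lambda)\in B(Y,X)$ is a generalized resolvent on $U$ of the linear pencil $\lambda\mapsto T-\lambda S$ if: (i) $(T-\lambda S)G(\lambda)(T-\lambda S)=T-\lambda S$ for all $\lambda\in U$; (ii) $G(\lambda)(T-\lambda S)G(\lambda)=G(\lambda)$ for all $\lambda\in U$; (iii) $G(\lambda)-G(\mu)=(\lambda-\mu)G(\lambda)SG(\mu)$ for all $\lambda,\mu\in U$. It is an analytic generalized resolvent if moreover $\lambda\mapsto G(\lambda)$ is analytic on $U$. Neighborhoods of $0$ are open subsets of $\mathbb{C}$ containing $0$. *)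

(* Defs.v *)
From HB Require Import structures.
From mathcomp Require Import all_boot all_order all_algebra.
From mathcomp Require Import all_classical all_reals all_analysis.
From mathcomp Require Import complex.

Set Implicit Arguments.
Unset Strict Implicit.
Unset Printing Implicit Defensive.

Import Order.TTheory GRing.Theory Num.Theory.
Import numFieldNormedType.Exports.

Local Open Scope classical_set_scope.
Local Open Scope ring_scope.
Local Open Scope complex_scope.

(* The regular algebra R[i]^o, rather than R[i] itself, carries the norm
   topology of the complex plane in the library. *)
Notation Cplx R := (R[i]^o).

Section Operators.
Variables (R : realType) (E F : normedModType R[i]).
Implicit Types f : E -> F.

Definition bounded_operator f : Prop :=
  linear f /\ exists M : R, forall x, `|f x| <= M%:C * `|x|.

(* `|_| takes its values in R[i]; it is real there, so Re loses nothing.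
   The supremum is the operator norm only when f is bounded. *)
Definition opnorm f : R :=
  sup [set complex.Re `|f x| | x in [set x : E | `|x| <= 1]].

End Operators.

Section Rank.
Variables (R : realType) (E F : normedModType R[i]).

Definition lin_indep (n : nat) (e : 'I_n -> F) : Prop :=
  forall c : 'I_n -> R[i], \sum_i c i *: e i = 0 -> forall i, c i = 0.

Definition lin_span (n : nat) (e : 'I_n -> F) : set F :=
  [set v | exists c : 'I_n -> R[i], v = \sum_i c i *: e i].

Definition has_dim (V : set F) (n : nat) : Prop :=
  exists e : 'I_n -> F, lin_indep e /\ V = lin_span e.

(* For a subspace V, Some n if V has dimension n and None if V has infinite
   dimension. *)
Definition dimension (V : set F) : option nat :=
  xget None [set Some n | n in has_dim V].

Definition Rank (f : E -> F) : option nat := dimension (range f).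

Definition finite_rank (f : E -> F) : Prop := exists n, Rank f = Some n.

End Rank.

Section GeneralizedResolvent.
Variables (R : realType) (X Y : normedModType R[i]).
Implicit Types (T S : X -> Y) (U : set (Cplx R)) (G : Cplx R -> Y -> X).

Definition pencil T S (lambda : R[i]) : X -> Y :=
  fun x => T x - lambda *: S x.

Definition generalized_resolvent T S U G : Prop :=
  [/\ forall lambda, U lambda -> bounded_operator (G lambda),
      forall lambda, U lambda ->
        pencil T S lambda \o G lambda \o pencil T S lambda = pencil T S lambda,
      forall lambda, U lambda ->
        G lambda \o pencil T S lambda \o G lambda = G lambda
    & forall lambda mu, U lambda -> U mu ->
        (fun y => G lambda y - G mu y) =
        (fun y => (lambda - mu) *: G lambda (S (G mu y)))].

(* Around each point of U, G is the sum of a power series with coefficients in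
   B(Y, X), converging in operator norm. *)
Definition analytic_on U G : Prop :=
  forall mu, U mu -> exists (r : R) (A : nat -> Y -> X),
    [/\ 0 < r,
        forall k, bounded_operator (A k)
      & forall lambda, U lambda -> `|lambda - mu| < r%:C ->
          opnorm (fun y =>
            G lambda y - \sum_(k < n) (lambda - mu) ^+ k *: A k y)
            @[n --> \oo] --> (0 : R)].

Definition analytic_generalized_resolvent T S U G : Prop :=
  generalized_resolvent T S U G /\ analytic_on U G.

End GeneralizedResolvent.

Definition open_neighborhood0 (R : realType) (U : set (Cplx R)) : Prop :=
  open U /\ U 0.

(* Main.v *)
(** If G is a generalized resolvent, the resolvent identity makes the range of
    G(l) independent of l, while T - l S and G(l), being generalized inverses of
    each other, have the same rank; so the rank of T - l S is constant.

    Conversely, let e_1, ..., e_n be a basis of the range of T, choose x_j with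
    T x_j = e_j and, by Hahn-Banach, bounded functionals psi_i with
    psi_i(e_j) = delta_ij.  With C := (psi_i(S x_j)) and L c := sum_j c_j x_j,
    the operators G(l) := L (1 - l C)^-1 psi, defined where 1 - l C is
    invertible, satisfy (ii) and (iii) unconditionally, and (i) when T - l S has
    rank n, because the vectors (T - l S) x_j are then a basis of its range.
    Analyticity is automatic: iterating the resolvent identity gives
    G(l) - sum_(k < n) (l - m)^k (G(m) S)^k G(m) = (l - m)^n (G(m) S)^n G(l). *)
Require Import Defs.
From HB Require Import structures.
From mathcomp Require Import all_boot all_order all_algebra.
From mathcomp Require Import all_classical all_reals all_analysis.
From mathcomp Require Import complex lra.

Set Implicit Arguments.
Unset Strict Implicit.
Unset Printing Implicit Defensive.

Import Order.TTheory GRing.Theory Num.Theory.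
Import numFieldNormedType.Exports.

Local Open Scope classical_set_scope.
Local Open Scope ring_scope.
Local Open Scope complex_scope.

(** * Real Hahn-Banach theorem through minimal sublinear functionals *)

Section HahnBanach.
Variables (R : realType) (V : lmodType R).
Implicit Types (p q f : V -> R) (x y : V) (A : set (V -> R)).

(** Homogeneity is asked only as an inequality, which passes to infima; [sublinearZ] recovers
    equality by applying it to the inverse scalar. *)
Definition sublinear p :=
  (forall x y, p (x + y) <= p x + p y) /\
  (forall (t : R) x, 0 < t -> p (t *: x) <= t * p x).

Lemma sublinear0 p : sublinear p -> p 0 = 0.
Proof.
move=> [_ pZ]; have := pZ 2 0; have := pZ 2^-1 0.
by rewrite !scaler0 invr_gt0 ltr0n => /(_ isT) ? /(_ isT) ?; lra.
Qed.

Lemma sublinear_ge_opp p x : sublinear p -> - p (- x) <= p x.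
Proof.
by move=> sp; have := sp.1 x (- x); rewrite subrr (sublinear0 sp) => ?; lra.
Qed.

Definition pointwise_inf A x : R := inf [set f x | f in A].

Lemma pointwise_inf_le A f x (l : R) : (forall g, A g -> l <= g x) -> A f ->
  pointwise_inf A x <= f x.
Proof.
move=> lA Af; apply: ge_inf; last by exists f.
by exists l => _ [g Ag <-]; exact: lA.
Qed.

Lemma pointwise_inf_ge A x (l : R) : A !=set0 -> (forall g, A g -> l <= g x) ->
  l <= pointwise_inf A x.
Proof.
move=> [f Af] lA; apply: lb_le_inf; first by exists (f x); exists f.
by move=> _ [g Ag <-]; exact: lA.
Qed.

(** The lower bound [l] makes each infimum genuine. Closure up to domination covers both the family
    of [flatten_along], where parameters add, and a chain, where the smaller of two members serves
    as [h]. *)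
Lemma sublinear_pointwise_inf A (l : V -> R) : A !=set0 ->
    (forall f x, A f -> l x <= f x) ->
    (forall f g, A f -> A g ->
      exists2 h, A h & forall x y, h (x + y) <= f x + g y) ->
    (forall f (t : R), 0 < t -> A f ->
      exists2 h, A h & forall x, h (t *: x) <= t * f x) ->
  sublinear (pointwise_inf A).
Proof.
move=> A0 lA AD AZ; split=> [x y|t x t0].
  rewrite -lerBlDr; apply: pointwise_inf_ge => // f Af.
  rewrite lerBlDr [leRHS]addrC -lerBlDr; apply: pointwise_inf_ge => // g Ag.
  rewrite lerBlDr [leRHS]addrC; have [h Ah hfg] := AD f g Af Ag.
  apply: le_trans (hfg x y).
  by apply: (@pointwise_inf_le _ _ _ (l (x + y))) => // k; exact: lA.
rewrite mulrC -ler_pdivrMr//; apply: pointwise_inf_ge => // f Af.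
rewrite ler_pdivrMr// mulrC; have [h Ah hf] := AZ f t t0 Af.
apply: le_trans (hf x).
by apply: (@pointwise_inf_le _ _ _ (l (t *: x))) => // k; exact: lA.
Qed.

Lemma sublinearZ p (t : R) x : sublinear p -> 0 <= t -> p (t *: x) = t * p x.
Proof.
move=> sp; rewrite le0r => /predU1P[->|t0].
  by rewrite scale0r mul0r sublinear0.
apply/eqP; rewrite eq_le sp.2//=.
have := sp.2 t^-1 (t *: x); rewrite invr_gt0 t0 => /(_ isT).
by rewrite scalerA mulVf ?gt_eqF// scale1r mulrC ler_pdivlMr// mulrC.
Qed.

(* The largest sublinear minorant of q whose value at -y is at most -q y. *)
Definition flatten_along q y : V -> R :=
  pointwise_inf [set f | exists2 t : R, 0 <= t &
                         f = fun x => q (x + t *: y) - t * q y].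

(** Subadditivity bounds the family below by [- q (- x)]; the parameters [t = 0] and [t = 1] give
    the two upper bounds. *)
Lemma flatten_alongP q y : sublinear q ->
  [/\ sublinear (flatten_along q y),
      forall x, flatten_along q y x <= q x
    & forall x, flatten_along q y x <= q (x + y) - q y].
Proof.
move=> sq; have [qD qZ] := sq; rewrite /flatten_along; set A := [set f | _].
have lA f x : A f -> - q (- x) <= f x.
  move=> [t t0 ->]; have := qD (x + t *: y) (- x).
  by rewrite addrAC subrr add0r (sublinearZ _ sq)// => ?; lra.
have ub (t : R) x : 0 <= t -> pointwise_inf A x <= q (x + t *: y) - t * q y.
  move=> t0; pose f x := q (x + t *: y) - t * q y.
  apply: (@pointwise_inf_le A f x (- q (- x))); last by exists t.
  by move=> g Ag; exact: lA.
split; first apply: (@sublinear_pointwise_inf A (fun x => - q (- x))) => //.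
- by eexists; exists 0.
- move=> _ _ [s s0 ->] [t t0 ->]; eexists.
    by exists (s + t) => //; rewrite addr_ge0.
  move=> x z /=; have := qD (x + s *: y) (z + t *: y).
  by rewrite addrACA -scalerDl => ?; lra.
- move=> _ t t0 [s s0 ->]; eexists.
    by exists (t * s) => //; rewrite mulr_ge0// ltW.
  move=> x /=; have := qZ t (x + s *: y) t0.
  by rewrite scalerDr scalerA => ?; lra.
- by move=> x; have := ub 0 x (lexx _); rewrite scale0r addr0 mul0r subr0.
- by move=> x; have := ub 1 x ler01; rewrite scale1r mul1r.
Qed.

(** Zorn's lemma for the reversed pointwise order: a nonempty chain is bounded by its pointwise
    infimum, kept finite by the common lower bound [- p (- x)]. *)
Lemma minimal_sublinear p : sublinear p ->
  exists q, [/\ sublinear q, forall x, q x <= p x &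
    forall r, sublinear r -> (forall x, r x <= q x) -> r = q].
Proof.
move=> sp; pose D := {q | sublinear q /\ forall x, q x <= p x}.
pose le (q r : D) := `[< forall x, sval r x <= sval q x >].
have pD : sublinear p /\ forall x, p x <= p x by [].
have lb (q : D) x : - p (- x) <= sval q x.
  case: q => q [sq qp] /=; apply: le_trans (sublinear_ge_opp x sq).
  by rewrite lerN2.
have [||||[q [sq qp]] qmin] := @Zorn D le.
- by move=> q; apply/asboolP.
- move=> q r s /asboolP qr /asboolP rs; apply/asboolP => x.
  exact: le_trans (rs x) (qr x).
- move=> [q hq] [r hr] /asboolP/= qr /asboolP/= rq; apply: eq_exist.
  by apply/funext => x; apply/eqP; rewrite eq_le qr rq.
- move=> A Atot; have [[q0 Aq0]|A0] := pselect (A !=set0); last first.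
    by exists (exist _ p pD) => q Aq; exfalso; apply: A0; exists q.
  pose B := [set sval q | q in A].
  have lB f x : B f -> - p (- x) <= f x by move=> [q Aq <-].
  have infB (q : D) x : A q -> pointwise_inf B x <= sval q x.
    move=> Aq; apply: (@pointwise_inf_le _ _ _ (- p (- x))); last by exists q.
    by move=> g Bg; exact: lB.
  have sB : sublinear (pointwise_inf B).
    apply: (@sublinear_pointwise_inf B (fun x => - p (- x))) => //.
    - by exists (sval q0), q0.
    - move=> _ _ [q Aq <-] [r Ar <-].
      have [/asboolP qr|/asboolP rq] := Atot _ _ Aq Ar.
        exists (sval r); first by exists r.
        move=> x y; apply: le_trans ((svalP r).1.1 x y) _.
        by rewrite lerD2r.
      exists (sval q); first by exists q.
      move=> x y; apply: le_trans ((svalP q).1.1 x y) _.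
      by rewrite lerD2l.
    - move=> _ t t0 [q Aq <-]; exists (sval q); first by exists q.
      by move=> x; exact: (svalP q).1.2.
  have Bp x : pointwise_inf B x <= p x.
    exact: le_trans (infB _ _ Aq0) ((svalP q0).2 x).
  pose i : D := exist _ (pointwise_inf B) (conj sB Bp).
  exists i => q Aq; apply/asboolP => x; exact: infB.
exists q; split=> // r sr rq.
have hr : sublinear r /\ forall x, r x <= p x.
  by split=> // x; exact: le_trans (rq x) (qp x).
have := qmin (exist _ r hr); rewrite /le /= => /(_ _)/(congr1 sval)/= -> //.
exact/asboolP.
Qed.

(* Flattening a minimal sublinear functional along y does not change it, which
   forces q x + q y <= q (x + y). *)
Theorem hahn_banach p e : sublinear p ->
  exists f : V -> R, [/\ scalar f, forall x, f x <= p x & f e = p e].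
Proof.
(* Flattening along [e] first forces [q (- e) <= - p e], which linearity turns into [p e <= q e]. *)
move=> sp; have [spe pep pee] := flatten_alongP e sp.
have [q [sq qpe qmin]] := minimal_sublinear spe.
have qp x : q x <= p x by exact: le_trans (qpe x) (pep x).
have qD x y : q (x + y) = q x + q y.
  have [sqy qyq qyy] := flatten_alongP y sq.
  apply/eqP; rewrite eq_le sq.1/=.
  by have := qyy x; rewrite (qmin _ sqy qyq) => ?; lra.
have qN x : q (- x) = - q x.
  by have := qD x (- x); rewrite subrr (sublinear0 sq) => ?; lra.
exists q; split=> //.
- move=> a x y; rewrite qD; congr (_ + _).
  have [a0|a0] := leP 0 a; first by rewrite sublinearZ.
  rewrite -[a]opprK scaleNr qN sublinearZ// ?mulNr//.
  by rewrite oppr_ge0 ltW.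
- apply/eqP; rewrite eq_le qp/=.
  have := pee (- e); have := qpe (- e).
  by rewrite addNr (sublinear0 sp) qN => ? ?; lra.
Qed.
End HahnBanach.

(** * Linearity laws for bare functions *)

Section LinearProp.
Variables (K : pzRingType) (V W : lmodType K) (f : V -> W) (f_linear : linear f).

Let g : {linear V -> W} := HB.pack f (GRing.isLinear.Build _ _ _ _ f f_linear).

Lemma linear_fun0 : f 0 = 0. Proof. exact: (linear0 g). Qed.
Lemma linear_funB x y : f (x - y) = f x - f y. Proof. exact: (linearB g). Qed.
Lemma linear_funZ a x : f (a *: x) = a *: f x. Proof. exact: (linearZZ g). Qed.
Lemma linear_fun_lincomb n (c : 'I_n -> K) (e : 'I_n -> V) :
  f (\sum_i c i *: e i) = \sum_i c i *: f (e i).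
Proof.
rewrite -[f]/(g : _ -> _) linear_sum; apply: eq_bigr => i _.
exact: linear_funZ.
Qed.
End LinearProp.

(** * Closure properties of bounded operators and the operator norm *)

Section BoundedOperators.
Variable R : realType.
Implicit Types E F H : normedModType R[i].

Lemma real_complexM (a b : R) : (a * b)%:C = a%:C * b%:C.
Proof. exact: rmorphM. Qed.

Lemma ge0_RRe (z : R[i]) : 0 <= z -> (complex.Re z)%:C = z.
Proof. by move=> z0; rewrite RRe_real// ger0_real. Qed.

(** The constant in [bounded_operator] carries no sign; a nonnegative one can be multiplied into
    other bounds. *)
Lemma bounded_operatorP E F (f : E -> F) : bounded_operator f ->
  exists2 M : R, 0 <= M & forall x, `|f x| <= M%:C * `|x|.
Proof.
move=> [_ [M fM]]; exists `|M| => // x; apply: le_trans (fM x) _.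
by rewrite ler_wpM2r// lecR ler_norm.
Qed.

Lemma bounded_operatorD E F (f g : E -> F) :
  bounded_operator f -> bounded_operator g ->
  bounded_operator (fun x => f x + g x).
Proof.
move=> [fl [M fM]] [gl [N gN]]; split.
  by move=> a x y; rewrite fl gl scalerDr addrACA.
exists (M + N) => x; apply: le_trans (ler_normD _ _) _.
by rewrite rmorphD mulrDl lerD.
Qed.

Lemma bounded_operator_comp E F H (g : F -> H) (f : E -> F) :
  bounded_operator g -> bounded_operator f -> bounded_operator (g \o f).
Proof.
move=> bg bf; split.
  by move=> a x y /=; rewrite bf.1 bg.1.
have [M M0 gM] := bounded_operatorP bg; have [N N0 fN] := bounded_operatorP bf.
exists (M * N) => x; apply: le_trans (gM _) _.
by rewrite real_complexM -mulrA ler_wpM2l// ?ler0c.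
Qed.

Lemma bounded_operator_scale E F (f : E -> F) a :
  bounded_operator f -> bounded_operator (fun x => a *: f x).
Proof.
move=> bf; split.
  by move=> b x y; rewrite bf.1 scalerDr !scalerA mulrC.
have [M M0 fM] := bounded_operatorP bf.
exists (complex.Re `|a| * M) => x; rewrite real_complexM ge0_RRe// -mulrA normrZ.
by rewrite ler_wpM2l.
Qed.

Lemma bounded_operator0 E F : bounded_operator (fun _ : E => 0 : F).
Proof.
split; first by move=> a x y; rewrite scaler0 addr0.
by exists 0 => x; rewrite normr0 mul0r.
Qed.

Lemma bounded_operator_sum E F n (f : 'I_n -> E -> F) :
  (forall i, bounded_operator (f i)) -> bounded_operator (fun x => \sum_i f i x).
Proof.
move=> bf; elim: n f bf => [|n IH] f bf.
  by under eq_fun do rewrite big_ord0; exact: bounded_operator0.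
under eq_fun do rewrite big_ord_recl.
by apply: bounded_operatorD => //; exact: IH.
Qed.

Lemma bounded_operator_rank1 E F (psi : E -> R[i]^o) (x : F) :
  bounded_operator psi -> bounded_operator (fun y => psi y *: x).
Proof.
move=> bpsi; split.
  by move=> a y z; rewrite bpsi.1 scalerDl scalerA.
have [M M0 psiM] := bounded_operatorP bpsi.
exists (M * complex.Re `|x|) => y; rewrite real_complexM ge0_RRe// normrZ mulrAC.
by rewrite ler_wpM2r.
Qed.

(** The value at 0 makes the set under the supremum nonempty and the supremum nonnegative; [M]
    bounds the set above. *)
Lemma opnorm_le E F (f : E -> F) (M : R) : 0 <= M ->
  (forall x, `|f x| <= M%:C * `|x|) -> 0 <= opnorm f <= M.
Proof.
move=> M0 fM; set A := [set complex.Re `|f x| | x in [set x : E | `|x| <= 1]].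
have A0 : A (complex.Re `|f 0|) by exists 0 => //=; rewrite normr0.
have AM : ubound A M.
  move=> _ [x /= x1 <-]; rewrite -lecR ge0_RRe//; apply: le_trans (fM x) _.
  by rewrite ler_piMr// ler0c.
apply/andP; split; last first.
  by apply: (ge_sup _ AM); exists (complex.Re `|f 0|).
apply: (@le_trans _ _ (complex.Re `|f 0|)); first by rewrite -ler0c ge0_RRe.
by apply: ub_le_sup => //; exists M.
Qed.

End BoundedOperators.

(** * Restriction of scalars from the complex to the real numbers *)

Section Realification.
Variables (R : realType) (V : lmodType R[i]).

(** A separate name for [V] keeps the real scalar action from clashing with the complex one. *)
Definition realification : Type := V.

HB.instance Definition _ := GRing.Zmodule.on realification.

Let scale (a : R) (v : realification) : realification := a%:C *: (v : V).

Let scaleA a b v : scale a (scale b v) = scale (a * b) v.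
Proof. by rewrite /scale scalerA real_complexM. Qed.

Let scale1 : left_id 1 scale.
Proof. by move=> v; rewrite /scale rmorph1 scale1r. Qed.

Let scaleDr : right_distributive scale +%R.
Proof. by move=> a u v; rewrite /scale scalerDr. Qed.

Let scaleDl v : {morph scale^~ v : a b / a + b}.
Proof. by move=> a b; rewrite /scale rmorphD scalerDl. Qed.

HB.instance Definition _ := GRing.Zmodule_isLmodule.Build R realification
  scaleA scale1 scaleDr scaleDl.

Lemma realification_scaleE (a : R) (v : realification) :
  a *: v = a%:C *: (v : V) :> V.
Proof. by []. Qed.

End Realification.

(** * Complex functionals separating a nonzero vector from 0 *)

Section SeparatingFunctionals.
Variables (R : realType) (V : normedModType R[i]).

Lemma ReD (a b : R[i]) : complex.Re (a + b) = complex.Re a + complex.Re b.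
Proof. by case: a b => [? ?] [? ?]. Qed.

Lemma ReZ (t : R) (a : R[i]) : complex.Re (t%:C * a) = t * complex.Re a.
Proof. by case: a => a b /=; rewrite mul0r subr0. Qed.

Lemma sublinear_norm : sublinear (fun x : realification V => complex.Re `|x : V|).
Proof.
split=> [x y|t x t0].
  by rewrite -ReD; have := ler_normD (x : V) y; rewrite lecE => /andP[].
rewrite realification_scaleE normrZ ger0_norm; last by rewrite ler0c ltW.
by rewrite ReZ.
Qed.

(** Real Hahn-Banach for the norm yields [f] with [f e] equal to the norm of [e]; [f] is then
    complexified and normalized at [e]. *)
Lemma separating_functional (e : V) : e != 0 ->
  exists2 phi : V -> R[i]^o, bounded_operator phi & phi e = 1.
Proof.
move=> e0.
have [f [flin fle fe]] := hahn_banach (e : realification V) sublinear_norm.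
have fD x y : f (x + y) = f x + f y by have := flin 1 x y; rewrite scale1r mul1r.
have f0 : f 0 = 0 by have := fD 0 0; rewrite addr0 => ?; lra.
have fZ (a : R) (x : V) : f (a%:C *: x) = a * f x.
  by have := flin a x 0; rewrite f0 !addr0.
have fN (x : V) : f (- x) = - f x.
  by have := fD x (- x); rewrite subrr f0 => ?; lra.
(* The complex-linear functional whose real part is [f]. *)
pose phi (x : V) : R[i]^o := f x +i* - f ('i *: x).
have phiD x y : phi (x + y) = phi x + phi y.
  by rewrite /phi scalerDr !fD opprD.
have phiZ a x : phi (a *: x) = a *: phi x.
  case: a => a b; rewrite /phi.
  have -> : (a +i* b) *: x = a%:C *: x + b%:C *: ('i *: x).
    by rewrite scalerA -scalerDl; congr (_ *: _); simpc.
  have ii : 'i *: ('i *: x) = - x by rewrite scalerA -expr2 sqr_i scaleN1r.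
  have ci (c : R) (y : V) : 'i *: (c%:C *: y) = c%:C *: ('i *: y).
    by rewrite !scalerA mulrC.
  rewrite scalerDr !ci ii !fD !fZ fN.
  rewrite /GRing.scale/=; simpc; congr (_ +i* _); lra.
have blphi : bounded_operator phi.
  split; first by move=> a x y; rewrite phiD phiZ.
  (* The real and imaginary parts of [phi x] are each at most the norm of [x]. *)
  exists 2 => x.
  have fabs (y : V) : `|f y| <= complex.Re `|y|.
    rewrite ler_norml fle andbT lerNl -fN; apply: le_trans (fle _) _.
    by rewrite normrN.
  have -> : phi x = (f x)%:C + (- f ('i *: x))%:C * 'i by simpc.
  apply: le_trans (ler_normD _ _) _.
  rewrite normrM [`|'i|]normc_def/= expr0n/= add0r expr1n sqrtr1 mulr1.
  rewrite !normc_def/= !expr0n/= !addr0 !sqrtr_sqr normrN -rmorphD.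
  rewrite -(ge0_RRe (normr_ge0 x)) -real_complexM lecR mulr_natl.
  rewrite mulr2n lerD//.
  apply: le_trans (fabs _) _; rewrite normrZ.
  by rewrite normc_def/= expr0n/= add0r expr1n sqrtr1 mul1r.
have phie : phi e != 0.
  apply/eqP => /(congr1 (@complex.Re R))/=; rewrite fe => e1.
  move: e0; rewrite -normr_eq0 -(ge0_RRe (normr_ge0 e)) e1.
  by rewrite eqxx.
exists (fun x => (phi e)^-1 *: phi x); first exact: bounded_operator_scale.
exact: mulVf.
Qed.
End SeparatingFunctionals.

(** * Bounded functionals biorthogonal to an independent family *)

Section Biorthogonal.
Variables (R : realType) (F : normedModType R[i]).

Lemma lin_indep_widen n (e : 'I_n.+1 -> F) :
  lin_indep e -> lin_indep (fun i : 'I_n => e (lift ord_max i)).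
Proof.
move=> ie c c0 i.
pose d j := if unlift ord_max j is Some k then c k else 0.
have := ie d; rewrite (bigD1_ord ord_max)//= /d unlift_none scale0r add0r.
under eq_bigr do rewrite liftK.
by move=> /(_ c0 (lift ord_max i)); rewrite liftK.
Qed.

(* Gram-Schmidt on the functionals: only separation of a nonzero vector from 0
   is needed, not the closedness of finite-dimensional subspaces. *)
Lemma biorthogonal_functionals n (e : 'I_n -> F) : lin_indep e ->
  exists2 psi : 'I_n -> F -> R[i]^o, forall i, bounded_operator (psi i) &
    forall i j, psi i (e j) = (i == j)%:R.
Proof.
elim: n e => [|n IH] e ie; first by exists (fun=> fun=> 0) => -[].
have [psi bpsi psie] := IH _ (lin_indep_widen ie).
pose w (i : 'I_n) := e (lift ord_max i); pose v := e ord_max.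
(* The last vector minus its projection along the others; [u = 0] would be a linear relation with
   coefficient 1 on [v]. *)
pose u := v - \sum_i psi i v *: w i.
have u0 : u != 0.
  apply/eqP => u0.
  pose d j := if unlift ord_max j is Some k then - psi k v else 1.
  suff /ie/(_ ord_max) : \sum_i d i *: e i = 0.
    by rewrite /d unlift_none => /eqP; rewrite oner_eq0.
  rewrite (bigD1_ord ord_max)//= /d unlift_none scale1r.
  under eq_bigr do rewrite liftK scaleNr.
  by rewrite sumrN.
have [phi bphi phiu] := separating_functional u0.
(* This is [phi] composed with the map subtracting that projection, so it kills each [w j] and takes
   the value [phi u = 1] at [v]. *)
pose chi y : R[i]^o := phi y + \sum_i - phi (w i) *: psi i y.
have bchi : bounded_operator chi.
  apply: bounded_operatorD => //; apply: bounded_operator_sum => i.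
  exact: bounded_operator_scale.
have chiw j : chi (w j) = 0.
  rewrite /chi (bigD1 j)//= psie eqxx big1 ?addr0; last first.
    by move=> i /negPf ij; rewrite psie ij scaler0.
  by rewrite -[_ *: _]/(_ * _) mulr1 subrr.
have chiv : chi v = 1.
  rewrite -phiu /u (linear_funB bphi.1) (linear_fun_lincomb bphi.1) /chi.
  congr (_ + _); rewrite -sumrN; apply: eq_bigr => i _.
  by rewrite scaleNr; congr (- _); exact: mulrC.
(* The old functionals are corrected to vanish at [v]; their values at the [w j], where [chi]
   vanishes, are unchanged. *)
pose psi' j y : R[i]^o :=
  if unlift ord_max j is Some k then psi k y + - psi k v *: chi y else chi y.
exists psi' => i.
  rewrite /psi'; case: unliftP => [k _|_] //.
  by apply: bounded_operatorD => //; exact: bounded_operator_scale.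
move=> j; rewrite /psi'.
case: (unliftP ord_max i) => [k ->|->]; case: (unliftP ord_max j) => [l ->|->].
- by rewrite chiw scaler0 addr0 psie (inj_eq lift_inj).
- by rewrite chiv -[_ *: _]/(_ * _) mulr1 subrr eq_sym (negPf (neq_lift _ _)).
- by rewrite chiw (negPf (neq_lift _ _)).
- by rewrite chiv eqxx.
Qed.

End Biorthogonal.

(** * Dimension of spans and rank of generalized inverses *)

Section Dimension.
Variable R : realType.
Implicit Types E F : normedModType R[i].

Lemma dimension_Some F (V : set F) n : dimension V = Some n -> has_dim V n.
Proof.
by rewrite /dimension; case: xgetP => // _ _ [m Vm <-] [<-].
Qed.

Lemma lin_span_mem F n (e : 'I_n -> F) i : lin_span e (e i).
Proof.
exists (fun j => (j == i)%:R).
rewrite (bigD1 i)//= eqxx scale1r big1 ?addr0// => j /negPf ->.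
exact: scale0r.
Qed.

(** The coordinates of [w] in a basis form a square matrix. A row in its left kernel is a linear
    relation among the [w i], so the matrix is invertible and basis and [w] have the same span. *)
Lemma lin_span_eq F (V : set F) n (w : 'I_n -> F) :
  has_dim V n -> lin_indep w -> (forall i, V (w i)) -> V = lin_span w.
Proof.
move=> [e [ie ->]] iw /choice[a wa].
pose A := \matrix_(i, j) a i j.
have combE (c : 'rV[R[i]]_n) :
    \sum_i c 0 i *: w i = \sum_j (c *m A) 0 j *: e j.
  under eq_bigr do rewrite wa scaler_sumr.
  rewrite exchange_big; apply: eq_bigr => j _.
  rewrite mxE scaler_suml; apply: eq_bigr => i _.
  by rewrite scalerA mxE.
have uA : A \in unitmx.
  rewrite -row_free_unit -kermx_eq0; apply/eqP/row_matrixP => k.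
  apply/rowP => i; rewrite row0 [RHS]mxE.
  apply: (iw (fun i => (row k (kermx A)) 0 i)).
  rewrite combE -row_mul mulmx_ker row0.
  by rewrite big1// => j _; rewrite mxE scale0r.
apply/seteqP; split=> v [c ->].
  exists (fun i => ((\row_j c j) *m invmx A) 0 i).
  rewrite combE mulmxKV//.
  by apply: eq_bigr => j _; rewrite mxE.
exists (fun j => ((\row_i c i) *m A) 0 j).
by rewrite -combE; apply: eq_bigr => j _; rewrite mxE.
Qed.

(** Since [A \o G] fixes the range of [A], [G] carries a basis of it to a basis of the range of
    [G]. *)
Lemma has_dim_range_ginv E F (A : E -> F) (G : F -> E) n :
    linear A -> linear G -> A \o G \o A = A -> G \o A \o G = G ->
  has_dim (range A) n -> has_dim (range G) n.
Proof.
move=> lA lG AGA GAG [e [ie rA]].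
have AGe i : A (G (e i)) = e i.
  have [x _ <-] : range A (e i) by rewrite rA; exact: lin_span_mem.
  by rewrite -[RHS](congr1 (fun f => f x) AGA).
exists (G \o e); split=> [c Gc0|].
  apply: ie; rewrite -[RHS](linear_fun0 lA) -Gc0.
  rewrite (linear_fun_lincomb lA); apply: eq_bigr => i _.
  by rewrite /= AGe.
apply/seteqP; split=> x.
  move=> [y _ <-].
  have [c AGy] : lin_span e (A (G y)) by rewrite -rA; exists (G y).
  exists c; rewrite -(linear_fun_lincomb lG) -AGy.
  by rewrite -[LHS](congr1 (fun f => f y) GAG).
by move=> [c ->]; rewrite -(linear_fun_lincomb lG); eexists.
Qed.

(** The hypotheses are symmetric in [A] and [G], so the sets of possible dimensions coincide, also
    when both are empty. *)
Lemma Rank_ginv E F (A : E -> F) (G : F -> E) :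
    linear A -> linear G -> A \o G \o A = A -> G \o A \o G = G ->
  Rank A = Rank G.
Proof.
move=> lA lG AGA GAG; rewrite /Rank /dimension; congr (xget _ (image _ _)).
by apply/seteqP; split=> n; exact: has_dim_range_ginv.
Qed.

End Dimension.

(** * Analyticity of generalized resolvents *)

Section Resolvent.
Variables (R : realType) (X Y : normedModType R[i]) (T S : X -> Y).
Variables (U : set (Cplx R)) (G : Cplx R -> Y -> X).

Lemma linear_pencil l : linear T -> linear S -> linear (pencil T S l).
Proof.
move=> lT lS a x y; rewrite /pencil lT lS scalerDr opprD addrACA scalerBr.
by rewrite !scalerA mulrC.
Qed.

Lemma pencil0 : pencil T S 0 = T.
Proof. by apply/funext => x; rewrite /pencil scale0r subr0. Qed.

Lemma resolvent_expansion l m n y :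
    linear (G m) -> linear S ->
    (forall z, G m z - G l z = (m - l) *: G m (S (G l z))) ->
  G l y - \sum_(k < n) (l - m) ^+ k *: iter k (G m \o S) (G m y)
  = (l - m) ^+ n *: iter n (G m \o S) (G l y).
Proof.
move=> lG lS Gml; have lGS : linear (G m \o S).
  by move=> a u v /=; rewrite lS lG.
have lGSn k : linear (iter k (G m \o S)).
  by elim: k => [|k IH] a u v //; rewrite !iterS IH lGS.
elim: n => [|n IH]; first by rewrite big_ord0 subr0 expr0 scale1r.
rewrite big_ord_recr/= opprD addrA IH -scalerBr -(linear_funB (lGSn n)).
(* With [G m] on the left of the identity, the iterated operator is fixed and [l] enters only
   through the last factor. *)
have -> : G l y - G m y = (l - m) *: (G m \o S) (G l y).
  by rewrite -opprB Gml -scaleNr opprB.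
by rewrite (linear_funZ (lGSn n)) scalerA -exprSr -iterSr.
Qed.

Lemma generalized_resolvent_analytic : bounded_operator S ->
  generalized_resolvent T S U G -> analytic_on U G.
Proof.
move=> bS [bG _ _ Geq] m Um.
have bGS : bounded_operator (G m \o S).
  exact: bounded_operator_comp (bG _ Um) bS.
have [K K0 GSK] := bounded_operatorP bGS.
have bGSn k : bounded_operator (iter k (G m \o S)).
  elim: k => [|k IH]; last exact: (bounded_operator_comp bGS IH).
  by split=> //; exists 1 => x; rewrite mul1r.
have GSn k x : `|iter k (G m \o S) x| <= (K ^+ k)%:C * `|x|.
  elim: k => [|k IH]; first by rewrite mul1r.
  rewrite iterS exprS real_complexM -mulrA; apply: le_trans (GSK _) _.
  by rewrite ler_wpM2l// ler0c.
(* Adding 1 keeps the radius meaningful when [K = 0] and gives [d * K < 1] inside the disc. *)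
exists (K + 1)^-1, (fun k => iter k (G m \o S) \o G m); split.
- by rewrite invr_gt0 ltr_wpDl.
- by move=> k; exact: bounded_operator_comp (bGSn k) (bG _ Um).
move=> l Ul; rewrite -[X in X < _](ge0_RRe (normr_ge0 _)).
rewrite ltcR; set d := complex.Re _ => dK.
have d0 : 0 <= d by rewrite -ler0c ge0_RRe.
(* [M] may depend on [l], which is fixed while [n] grows; the remainder is at most
   [M * (d * K) ^+ n]. *)
have [M M0 GM] := bounded_operatorP (bG _ Ul).
have dK1 : `|d * K| < 1.
  rewrite ger0_norm ?mulr_ge0//.
  move: dK; rewrite -[_^-1]mul1r ltr_pdivlMr ?ltr_wpDl// => ?; lra.
apply: (@squeeze_cvgr _ _ _ _ (cst 0) (geometric M (d * K))).
- near=> n; apply: opnorm_le => [|y].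
    by rewrite /= mulr_ge0// exprn_ge0// mulr_ge0.
  rewrite /= resolvent_expansion//; [|exact: (bG _ Um).1|exact: bS.1|]; last first.
    by move=> z; exact: (congr1 (fun f => f z) (Geq _ _ Um Ul)).
  rewrite normrZ normrX -[X in X ^+ _ * _](ge0_RRe (normr_ge0 _)) -/d.
  rewrite mulrC exprMn mulrA !real_complexM.
  rewrite -!mulrA mulrCA (mulrCA M%:C) [leRHS]mulrC mulrC [leRHS]mulrC.
  have -> : (d ^+ n)%:C = d%:C ^+ n by exact: rmorphXn.
  rewrite ler_wpM2l ?exprn_ge0 ?ler0c//; apply: le_trans (GSn _ _) _.
  by rewrite ler_wpM2l// ler0c exprn_ge0.
- exact: cvg_cst.
- exact: cvg_geometric.
Unshelve. all: by end_near.
Qed.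

End Resolvent.

(** * Openness of the set where 1 - l C is invertible *)

Section OpenUnit.
Variable K : numFieldType.

Lemma continuous_horner_num (p : {poly K}) : continuous (horner p).
Proof.
elim/poly_ind: p => [|p c IH].
  have -> : horner 0 = cst 0 :> (K -> K).
    by apply/funext => l; rewrite horner0.
  exact: cst_continuous.
have -> : horner (p * 'X + c%:P) = (horner p \* id) \+ cst c.
  by apply/funext => l; rewrite hornerMXaddC.
move=> l; apply: (@continuousD _ K^o) (@cst_continuous _ _ c l).
by apply: (@continuousM _ _ (horner p) id) => //; exact: IH.
Qed.

Lemma open_unitmx_pencil n (C : 'M[K]_n) :
  open [set l : K | 1%:M - l *: C \in unitmx].
Proof.
(* The determinant is polynomial in [l], so the set is the preimage of the open complement of 0
   under a continuous map. *)
pose q : {poly K} := \det (1%:M - 'X *: map_mx polyC C).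
have qE (l : K) : q.[l] = \det (1%:M - l *: C).
  rewrite /q -/(horner_eval l _) -det_map_mx; congr (\det _).
  rewrite map_mxB map_mx1 map_mxZ/= /horner_eval hornerX -map_mx_comp.
  by congr (_ - _ *: _); apply/matrixP => i j; rewrite mxE/= hornerC.
have -> : [set l : K | 1%:M - l *: C \in unitmx] = horner q @^-1` (~` [set 0]).
  by apply/seteqP; split=> l /=; rewrite unitmxE unitfE qE => /eqP.
apply: open_comp; first by move=> l _; exact: continuous_horner_num.
rewrite openC; apply: accessible_closed_set1; apply: hausdorff_accessible.
exact: norm_hausdorff.
Qed.
End OpenUnit.

(** * Constancy of the rank along a generalized resolvent *)

Lemma Rank_resolvent (R : realType) (X Y : normedModType R[i]) (T S : X -> Y)
    (U : set (Cplx R)) (G : Cplx R -> Y -> X) l m :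
    linear T -> linear S -> generalized_resolvent T S U G -> U l -> U m ->
  Rank (pencil T S l) = Rank (pencil T S m).
Proof.
move=> lT lS [bG PGP GPG Geq] Ul Um.
have RankG k : U k -> Rank (pencil T S k) = Rank (G k).
  move=> Uk; apply: Rank_ginv; [exact: linear_pencil|exact: (bG k Uk).1| |].
  - exact: PGP.
  - exact: GPG.
have sub j k : U j -> U k -> range (G j) `<=` range (G k).
  (* The preimage comes from solving the resolvent identity at [k] and [j] for [G j y]. *)
  move=> Uj Uk _ [y _ <-]; exists (y - (k - j) *: S (G j y)) => //.
  have lGk := (bG k Uk).1; rewrite (linear_funB lGk) (linear_funZ lGk).
  rewrite -[X in _ - X](congr1 (fun f => f y) (Geq _ _ Uk Uj)).
  by rewrite opprB addrC subrK.
rewrite !RankG// /Rank; congr dimension.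
by apply/seteqP; split; exact: sub.
Qed.

(** * A generalized resolvent from the pencil compressed to n coordinates *)

Section Construction.
Variables (R : realType) (X Y : normedModType R[i]) (T S : X -> Y) (n : nat).
Variables (x : 'I_n -> X) (psi : 'I_n -> Y -> R[i]^o).
Hypotheses (lT : linear T) (lS : linear S).
Hypothesis bpsi : forall i, bounded_operator (psi i).
Hypothesis psiT : forall i j, psi i (T (x j)) = (i == j)%:R.

(** The matrix of [S] in the coordinates given by [L] and [Psi], in which [T] becomes the identity;
    [B l] is thus the compressed pencil. *)
Let C : 'M[R[i]]_n := \matrix_(i, j) psi i (S (x j)).
Let B (l : R[i]) := 1%:M - l *: C.
Let Psi y : 'cV[R[i]]_n := \col_i psi i y.
Let L (c : 'cV[R[i]]_n) : X := \sum_j c j 0 *: x j.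

(** Total in [l]: [invmx] returns a singular matrix unchanged. *)
Definition compressed_resolvent (l : Cplx R) (y : Y) : X :=
  L (invmx (B l) *m Psi y).

Let G := compressed_resolvent.

Let linL : linear L.
Proof.
move=> a c d; rewrite /L scaler_sumr -big_split; apply: eq_bigr => j _ /=.
by rewrite !mxE scalerDl scalerA.
Qed.

Let linPsi : linear Psi.
Proof.
by move=> a y z; apply/colP => i; rewrite !mxE (bpsi i).1.
Qed.

Let PsiT c : Psi (T (L c)) = c.
Proof.
apply/colP => i; rewrite mxE /L (linear_fun_lincomb lT).
rewrite (linear_fun_lincomb (bpsi i).1) (bigD1 i)//= psiT eqxx big1 ?addr0.
  exact: mulr1.
by move=> j ji; rewrite psiT eq_sym (negPf ji) scaler0.
Qed.

Let PsiS c : Psi (S (L c)) = C *m c.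
Proof.
apply/colP => i; rewrite !mxE /L (linear_fun_lincomb lS).
rewrite (linear_fun_lincomb (bpsi i).1); apply: eq_bigr => j _.
by rewrite mxE mulrC.
Qed.

Let PsiP l c : Psi (pencil T S l (L c)) = B l *m c.
Proof.
rewrite /pencil (linear_funB linPsi) (linear_funZ linPsi) PsiT PsiS.
by rewrite /B mulmxBl mul1mx scalemxAl.
Qed.

(** Expanding the matrix product shows a finite sum of bounded rank-one operators. *)
Lemma bounded_compressed_resolvent l : bounded_operator (G l).
Proof.
have -> : G l = fun y => \sum_j (\sum_i invmx (B l) j i *: psi i y) *: x j.
  apply/funext => y; apply: eq_bigr => j _; rewrite mxE; congr (_ *: _).
  by apply: eq_bigr => i _; rewrite mxE.
apply: bounded_operator_sum => j; apply: bounded_operator_rank1.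
by apply: bounded_operator_sum => i; exact: bounded_operator_scale.
Qed.

(* The vectors (T - l S) x_j are independent because B l is invertible, hence
   they span the range as soon as its dimension is n. *)
Lemma compressed_generalized_resolvent (U : set (Cplx R)) :
    (forall l, U l -> B l \in unitmx) ->
    (forall l, U l -> has_dim (range (pencil T S l)) n) ->
  generalized_resolvent T S U G.
Proof.
move=> UB Udim; split=> [l _|l Ul|l Ul|l m Ul Um].
- exact: bounded_compressed_resolvent.
- have lP := linear_pencil l lT lS.
  have PL c : pencil T S l (L (\col_i c i)) = \sum_j c j *: pencil T S l (x j).
    rewrite -(linear_fun_lincomb lP); congr (pencil _ _ _ _).
    by apply: eq_bigr => j _; rewrite mxE.
  have iPx : lin_indep (fun j => pencil T S l (x j)).
    move=> c; rewrite -PL => c0 i.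
    have := PsiP l (\col_i c i); rewrite c0 (linear_fun0 linPsi).
    move=> /(congr1 (mulmx (invmx (B l)))); rewrite mulmx0 mulKmx ?UB//.
    by move=> /colP/(_ i); rewrite !mxE.
  apply/funext => z /=.
  (* Every value of the pencil is already attained on the range of [L], where [G l] inverts the
     pencil. *)
  have [c ->] : lin_span (fun j => pencil T S l (x j)) (pencil T S l z).
    by rewrite -(lin_span_eq (Udim l Ul) iPx)//; exists z.
  by rewrite -PL /G /compressed_resolvent PsiP mulKmx ?UB.
- apply/funext => y /=.
  by rewrite /G /compressed_resolvent PsiP mulKmx ?UB.
- apply/funext => y; rewrite /G /compressed_resolvent PsiS.
  rewrite -(linear_funB linL) -(linear_funZ linL); congr L.
  rewrite !mulmxA -mulmxBl scalemxAl; congr (_ *m _).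
  (* The classical resolvent identity for matrices, from [B m - B l = (l - m) *: C]. *)
  have -> : (l - m) *: (invmx (B l) *m C *m invmx (B m)) =
      invmx (B l) *m (B m - B l) *m invmx (B m).
    have -> : B m - B l = (l - m) *: C.
      by rewrite /B opprB addrC addrA subrK scalerBl.
    by rewrite -scalemxAr -scalemxAl.
  by rewrite mulmxBr mulmxBl mulVmx ?UB// mul1mx -mulmxA mulmxV ?UB// mulmx1.
Qed.

End Construction.

Theorem theorem2p3 (R : realType) (X Y : completeNormedModType R[i])
    (T S : X -> Y) (hT : bounded_operator T) (hS : bounded_operator S)
    (hTfin : finite_rank T) :
  (exists (U : set (Cplx R)) (G : Cplx R -> Y -> X),
     open_neighborhood0 U /\ analytic_generalized_resolvent T S U G)
  <->
  (exists U : set (Cplx R),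
     open_neighborhood0 U /\
     forall lambda, U lambda -> Rank (pencil T S lambda) = Rank T).
Proof.
split=> [[U [G [[oU U0] [Gres _]]]]|[U [[oU U0] Urank]]].
  exists U; split=> // l Ul.
  by rewrite (Rank_resolvent hT.1 hS.1 Gres Ul U0) pencil0.
have [n Tn] := hTfin; have [e [ie rT]] := dimension_Some Tn.
have [psi bpsi psie] := biorthogonal_functionals ie.
have /choice[x xe] : forall i, exists x, T x = e i.
  move=> i; have [x _ xe] : range T (e i) by rewrite rT; exact: lin_span_mem.
  by exists x.
have psiT i j : psi i (T (x j)) = (i == j)%:R by rewrite xe.
pose C : 'M[R[i]]_n := \matrix_(i, j) psi i (S (x j)).
(* [U] supplies the rank, the second set the invertibility; 0 lies in it because the matrix there is
   the identity. *)
pose W := U `&` [set l : Cplx R | 1%:M - (l : R[i]) *: C \in unitmx].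
have GW : generalized_resolvent T S W (compressed_resolvent S x psi).
  apply: compressed_generalized_resolvent => //; [exact: hT.1|exact: hS.1| |].
  - by move=> l [].
  - by move=> l [Ul _]; apply: dimension_Some; rewrite -Tn; exact: Urank.
exists W, (compressed_resolvent S x psi); split; last first.
  by split=> //; exact: generalized_resolvent_analytic hS GW.
split; first by apply: openI => //; exact: open_unitmx_pencil.
by split=> //=; rewrite scale0r subr0 unitmx1.
Qed.
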